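(* Let $G$ be a connected simple graph on $n\ge 3$ vertices, and let $\Phi=\{\phi_i\}_{i\in[n]}$ be an $L_G(n,n-1)$-frame for $\mathbb{C}^{n-1}$ with frame operator $S_\Phi$. Then $\rho^{(2)}_{\Phi,S_\Phi^{-1}\Phi}=1$.
   Context: Write $[n]=\{1,\dots,n\}$; inner products on $\mathbb{C}^d$ are standard and linear in the first argument. A finite sequence $\Phi=\{\phi_i\}_{i\in[n]}$ in $\mathbb{C}^d$ is a frame for $\mathbb{C}^d$ if there are constants $0<A\le B$ with $A\|f\|^2\le\sum_{i\in[n]}|\langle f,\phi_i\rangle|^2\le B\|f\|^2$ for all $f\in\mathbb{C}^d$. Its frame operator is $S_\Phi f=\sum_{i\in[n]}\langle f,\phi_i\rangle\phi_i$ (invertible). A frame $\Psi=\{\psi_i\}_{i\in[n]}$ of $\mathbb{C}^d$ is a dual frame of $\Phi$ if $f=\sum_{i\in[n]}\langle f,\phi_i\rangle\psi_i=\sum_{i\in[n]}\langle f,\psi_i\rangle\phi_i$ for all $f\in\mathbb{C}^d$. The canonical dual frame of $\Phi$ is the dual frame $S_\Phi^{-1}\Phi:=\{S_\Phi^{-1}\phi_i\}_{i\in[n]}$. For a dual frame $\Psi$ of $\Phi$ and $\Lambda\subset[n]$, the error operator is $E_{\Phi,\Psi,\Lambda}(f)=\sum_{i\in\Lambda}\langle f,\phi_i\rangle\psi_i$ on $\mathbb{C}^d$, and for $1\le r<n$, $\rho^{(r)}_{\Phi,\Psi}:=\max\{\rho(E_{\Phi,\Psi,\Lambda}):\Lambda\subset[n],\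 |\Lambda|=r\}$, where $\rho(\cdot)$ is the spectral radius. Graph frames: for a simple graph $G$ with $n$ vertices $v_1,\dots,v_n$ and $n-k$ connected components, the Laplacian matrix is $L(G)=D(G)-A(G)$ (degree matrix minus adjacency matrix); it has rank $k$. Write $L(G)=M\,\mathrm{diag}(\lambda_1,\dots,\lambda_k,0,\dots,0)\,M^*$ with $M$ unitary and $\lambda_1,\dots,\lambda_k$ the nonzero eigenvalues, let $M_1$ be the submatrix formed by the first $k$ columns of $M$, and let $B=\mathrm{diag}(\sqrt{\lambda_1},\dots,\sqrt{\lambda_k})M_1^*$. Then $\{B e_i\}_{i\in[n]}$, with $\{e_i\}$ the standard basis of $\mathbb{C}^n$, is a frame for $\mathbb{C}^k$; any frame arising in this way is called an $L_G(n,k)$-frame. *)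

(* Defs.v *)
From HB Require Import structures.
From mathcomp Require Import all_boot all_order all_algebra.
From mathcomp Require Import all_classical all_reals.
From mathcomp Require Import complex ring.

Set Implicit Arguments.
Unset Strict Implicit.
Unset Printing Implicit Defensive.

Import Order.TTheory GRing.Theory Num.Theory.
Local Open Scope ring_scope.
Local Open Scope sesquilinear_scope.

Section Frames.
Variables (R : realType) (n d : nat).
Implicit Types (Phi Psi : 'I_n -> 'cV[R[i]]_d) (f g : 'cV[R[i]]_d).

(* linear in the first argument *)
Definition dotc f g : R[i] := \sum_(k < d) f k 0 * (g k 0)^*.

(* dotc f f is the squared norm of f *)
Definition is_frame Phi : Prop :=
  exists A B : R, [/\ 0 < A, A <= B &
    forall f, A%:C%C * dotc f f <= \sum_(i < n) `|dotc f (Phi i)| ^+ 2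
              /\ \sum_(i < n) `|dotc f (Phi i)| ^+ 2 <= B%:C%C * dotc f f].

Definition frame_op Phi : 'End('cV[R[i]]_d) :=
  linfun (fun f => \sum_(i < n) dotc f (Phi i) *: Phi i).

Definition is_dual_frame Phi Psi : Prop :=
  is_frame Psi /\
  forall f, f = \sum_(i < n) dotc f (Phi i) *: Psi i
            /\ f = \sum_(i < n) dotc f (Psi i) *: Phi i.

Lemma dotc_linear g : linear (dotc^~ g : 'cV[R[i]]_d -> R[i]^o).
Proof.
move=> a f1 f2; rewrite /dotc scaler_sumr -big_split; apply: eq_bigr => k _ /=.
by rewrite !mxE mulrDl /GRing.scale /= mulrA.
Qed.

Lemma sum_dotc_linear Phi Psi (P : pred 'I_n) :
  linear (fun f => \sum_(i < n | P i) dotc f (Phi i) *: Psi i).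
Proof.
move=> a f1 f2; rewrite scaler_sumr -big_split; apply: eq_bigr => k _ /=.
by rewrite (dotc_linear (Phi k) a f1 f2) scalerDl scalerA.
Qed.

Lemma sum_dotc_linfunE Phi Psi (P : pred 'I_n) f :
  linfun (fun f => \sum_(i < n | P i) dotc f (Phi i) *: Psi i) f =
  \sum_(i < n | P i) dotc f (Phi i) *: Psi i.
Proof.
pose h f := \sum_(i < n | P i) dotc f (Phi i) *: Psi i.
pose H := GRing.isLinear.Build _ _ _ _ h (sum_dotc_linear Phi Psi P).
pose L : {linear 'cV[R[i]]_d -> 'cV[R[i]]_d} := HB.pack h H.
exact: (lfunE L f).
Qed.

Lemma frame_opE Phi f : frame_op Phi f = \sum_(i < n) dotc f (Phi i) *: Phi i.
Proof. exact: sum_dotc_linfunE. Qed.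

Definition canonical_dual Phi : 'I_n -> 'cV[R[i]]_d :=
  fun i => (frame_op Phi)^-1%VF (Phi i).

Definition error_op Phi Psi (L : {set 'I_n}) : 'End('cV[R[i]]_d) :=
  linfun (fun f => \sum_(i in L) dotc f (Phi i) *: Psi i).

Lemma error_opE Phi Psi L f :
  error_op Phi Psi L f = \sum_(i in L) dotc f (Phi i) *: Psi i.
Proof. exact: sum_dotc_linfunE. Qed.

(* In finite dimension the spectrum is the set of eigenvalues, which is finite,
   and nonempty when 0 < d. *)
Definition spectral_radius (T : 'End('cV[R[i]]_d)) : R :=
  sup [set ComplexField.Normc.normc a
      | a in [set a | passmx.leigenvalue T a]]%classic.

(* Spectral radii are nonnegative, so the default value 0 of the iterated
   maximum plays no role when r <= n. *)
Definition rho_erasure (r : nat) Phi Psi : R :=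
  \big[Num.max/0]_(L : {set 'I_n} | #|L| == r)
    spectral_radius (error_op Phi Psi L).

Lemma dotcC f g : dotc g f = (dotc f g)^*.
Proof.
by rewrite /dotc rmorph_sum; apply: eq_bigr => k _; rewrite rmorphM /= conjCK mulrC.
Qed.

Lemma dotc_suml (I : finType) (P : pred I) (a : I -> R[i]) (F : I -> 'cV[R[i]]_d) g :
  dotc (\sum_(i | P i) a i *: F i) g = \sum_(i | P i) a i * dotc (F i) g.
Proof.
rewrite /dotc; under [RHS]eq_bigr do rewrite mulr_sumr.
rewrite exchange_big; apply: eq_bigr => k _; rewrite summxE mulr_suml.
by apply: eq_bigr => i _; rewrite mxE mulrA.
Qed.

Lemma dotc_sumr (I : finType) (P : pred I) (a : I -> R[i]) (F : I -> 'cV[R[i]]_d) f :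
  dotc f (\sum_(i | P i) a i *: F i) = \sum_(i | P i) (a i)^* * dotc f (F i).
Proof.
rewrite dotcC dotc_suml rmorph_sum; apply: eq_bigr => i _.
by rewrite rmorphM /= -dotcC.
Qed.

Lemma dotc_ge0 f : 0 <= dotc f f.
Proof. by apply: sumr_ge0 => k _; rewrite mul_conjC_ge0. Qed.

Lemma dotc_eq0 f : dotc f f = 0 -> f = 0.
Proof.
move=> /eqP; rewrite psumr_eq0 => [/allP f0|k _]; last exact: mul_conjC_ge0.
apply/colP => k; rewrite mxE; apply/eqP.
by have := f0 k; rewrite mem_index_enum mul_conjC_eq0 => /(_ isT).
Qed.

Lemma mean_ineq (c x y : R[i]) : 0 < c -> 0 <= x -> 0 <= y ->
  (x * y) *+ 2 <= c^-1 * x ^+ 2 + c * y ^+ 2.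
Proof.
move=> c0 x0 y0; rewrite -subr_ge0.
have -> : c^-1 * x ^+ 2 + c * y ^+ 2 - (x * y) *+ 2 = c^-1 * (x - c * y) ^+ 2.
  by field; rewrite gt_eqF.
rewrite mulr_ge0 ?invr_ge0 ?(ltW c0) // real_exprn_even_ge0 //.
by rewrite rpredB ?ger0_real // mulr_ge0 // ltW.
Qed.

Lemma norm_dotc_le (c : R[i]) f g : 0 < c ->
  `|dotc f g| *+ 2 <= c^-1 * dotc f f + c * dotc g g.
Proof.
move=> c0; apply: (@le_trans _ _ ((\sum_(k < d) `|f k 0| * `|g k 0|) *+ 2)).
  rewrite ler_pMn2r //; apply: (le_trans (ler_norm_sum _ _ _)).
  by apply: ler_sum => k _; rewrite normrM norm_conjC.
rewrite /dotc !mulr_sumr -big_split -sumrMnl; apply: ler_sum => k _ /=.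
by rewrite -!normCK; rewrite mean_ineq.
Qed.

Lemma dotc_frame_op Phi f g :
  dotc (frame_op Phi f) g = \sum_(i < n) dotc f (Phi i) * dotc (Phi i) g.
Proof. by rewrite frame_opE dotc_suml. Qed.

Lemma frame_op_adj Phi f g : dotc (frame_op Phi f) g = dotc f (frame_op Phi g).
Proof.
rewrite dotc_frame_op frame_opE dotc_sumr; apply: eq_bigr => i _.
by rewrite -dotcC mulrC.
Qed.

Lemma sqnorm_sum Phi f :
  \sum_(i < n) `|dotc f (Phi i)| ^+ 2 = dotc (frame_op Phi f) f.
Proof. by rewrite dotc_frame_op; apply: eq_bigr => i _; rewrite normCK (dotcC f). Qed.

Lemma frame_op_ker Phi : is_frame Phi -> lker (frame_op Phi) == 0%VS.
Proof.
move=> [A [B [A0 _ fr]]]; apply/lker0P/raddf_inj => f Sf.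
have [le_f _] := fr f; apply: dotc_eq0; apply/le_anti; rewrite dotc_ge0 andbT.
have A0' : 0 < A%:C%C :> R[i] by rewrite ltcR.
rewrite -(pmulr_rle0 _ A0'); apply: (le_trans le_f).
by rewrite sqnorm_sum Sf /dotc big1 // => k _; rewrite mxE mul0r.
Qed.

Section Inv.
Variable (Phi : 'I_n -> 'cV[R[i]]_d).
Hypothesis Phi_frame : is_frame Phi.
Let S := frame_op Phi.
Let SK : cancel S (S^-1)%VF. Proof. exact: lker0_lfunK (frame_op_ker _). Qed.
Let VSK : cancel (S^-1)%VF S. Proof. exact: lker0_lfunVK (frame_op_ker _). Qed.

Lemma dotc_canonical_dual f i :
  dotc f (canonical_dual Phi i) = dotc ((S^-1)%VF f) (Phi i).
Proof. by rewrite -{1}(VSK f) frame_op_adj /canonical_dual VSK. Qed.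

Lemma canonical_dual_reconstruct f :
  f = \sum_(i < n) dotc f (Phi i) *: canonical_dual Phi i
  /\ f = \sum_(i < n) dotc f (canonical_dual Phi i) *: Phi i.
Proof.
split; last first.
  rewrite -{1}(VSK f) frame_opE; apply: eq_bigr => i _.
  by rewrite dotc_canonical_dual.
rewrite -{1}(SK f) frame_opE linear_sum; apply: eq_bigr => i _.
by rewrite linearZ.
Qed.
Lemma canonical_dual_frame : is_frame (canonical_dual Phi).
Proof.
have [A [B [A0 AB fr]]] := Phi_frame.
have B0 : 0 < B by exact: lt_le_trans A0 AB.
have A0' : 0 < A%:C%C :> R[i] by rewrite ltcR.
have B0' : 0 < B%:C%C :> R[i] by rewrite ltcR.
exists B^-1, A^-1; split; rewrite ?invr_gt0 // ?lef_pV2 //.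
move=> f; rewrite !fmorphV /=.
have sumE : \sum_(i < n) `|dotc f (canonical_dual Phi i)| ^+ 2
            = dotc f ((S^-1)%VF f).
  under eq_bigr do rewrite dotc_canonical_dual.
  by rewrite sqnorm_sum VSK.
set T := \sum_(i < n) _ in sumE *.
have T0 : 0 <= T by apply: sumr_ge0 => i _; rewrite exprn_ge0.
split; last first.
  have [le1 _] := fr ((S^-1)%VF f).
  rewrite sqnorm_sum -/S VSK -sumE in le1.
  have := norm_dotc_le f ((S^-1)%VF f) A0'.
  rewrite -sumE ger0_norm // => le2.
  have := le_trans le2 (lerD (lexx _) le1).
  by rewrite mulr2n lerD2r.
have [_ le1] := fr f.
rewrite ler_pdivrMl //.
have : dotc f f *+ 2 <= B%:C%C * T
    + (B%:C%C)^-1 * \sum_(i < n) `|dotc f (Phi i)| ^+ 2.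
  have -> : dotc f f = \sum_(i < n) dotc f (canonical_dual Phi i)
                                   * (dotc f (Phi i))^*.
    rewrite {1}(canonical_dual_reconstruct f).2 dotc_suml.
    by apply: eq_bigr => i _; rewrite -dotcC.
  rewrite -[X in X *+ 2]ger0_norm; last first.
    under eq_bigr do rewrite -dotcC.
    by rewrite -dotc_suml -(canonical_dual_reconstruct f).2 dotc_ge0.
  apply: (@le_trans _ _ ((\sum_(i < n) `|dotc f (Phi i)|
             * `|dotc f (canonical_dual Phi i)|) *+ 2)).
    rewrite ler_pMn2r //; apply: (le_trans (ler_norm_sum _ _ _)).
    by apply: ler_sum => i _; rewrite normrM norm_conjC mulrC.
  rewrite addrC !mulr_sumr -big_split -sumrMnl; apply: ler_sum => i _ /=.
  by rewrite mean_ineq.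
move=> le2; have := le_trans le2 (lerD (lexx _) (_ : _ <= dotc f f)).
by rewrite mulr2n lerD2r; apply; rewrite ler_pdivrMl.
Qed.

Lemma canonical_dual_is_dual : is_dual_frame Phi (canonical_dual Phi).
Proof. by split; [exact: canonical_dual_frame|exact: canonical_dual_reconstruct]. Qed.
End Inv.

End Frames.

Record sgraph (n : nat) := SGraph {
  adj :> rel 'I_n;
  adj_sym : symmetric adj;
  adj_irrefl : irreflexive adj }.

Definition connected_graph (n : nat) (G : sgraph n) : Prop :=
  forall x y, connect G x y.

Section GraphFrames.
Variables (R : realType) (n : nat) (G : sgraph n).

Definition degree_mx : 'M[R[i]]_n := diag_mx (\row_i #|[set j | G i j]%SET|%:R).
Definition adjacency_mx : 'M[R[i]]_n := \matrix_(i, j) (G i j)%:R.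
Definition laplacian : 'M[R[i]]_n := degree_mx - adjacency_mx.

(* [lam] is the full diagonal (lambda_1, ..., lambda_k, 0, ..., 0) *)
Definition is_LG_frame (k : nat) (Phi : 'I_n -> 'cV[R[i]]_k) : Prop :=
  n_comp G predT = (n - k)%N /\
  exists (le_kn : (k <= n)%N) (M : 'M[R[i]]_n) (lam : 'rV[R[i]]_n),
    [/\ M \is unitarymx,
        forall j : 'I_n, (lam 0 j != 0) = (j < k)%N,
        laplacian = M *m diag_mx lam *m M^t* &
        let M1 := colsub (widen_ord le_kn) M in
        let B := diag_mx (\row_(i < k) sqrtC (lam 0 (widen_ord le_kn i)))
                 *m M1^t* in
        forall i : 'I_n, Phi i = B *m delta_mx i 0].

End GraphFrames.

Lemma dotcE (R : realType) d (f g : 'cV[R[i]]_d) : dotc f g = (g^t* *m f) 0 0.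
Proof. by rewrite mxE; apply: eq_bigr => k _; rewrite !mxE mulrC. Qed.

Lemma LG_frame_is_frame (R : realType) (n k : nat) (G : sgraph n)
    (Phi : 'I_n -> 'cV[R[i]]_k) :
  is_LG_frame G Phi -> is_frame Phi.
Proof.
case=> _ [le_kn [M [lam [Mu lamP _]]]] /=.
set D := diag_mx _; set M1 := colsub _ _ => PhiE.
pose w i := lam 0 (widen_ord le_kn i).
have w0 i : w i != 0 by rewrite lamP /=.
have M1K : M1^t* *m M1 = 1%:M.
  have /matrixP MK : M^t* *m M = 1%:M.
    by rewrite -invmx_unitary // mulVmx // unitarymx_unit.
  apply/matrixP => i j; have := MK (widen_ord le_kn i) (widen_ord le_kn j).
  rewrite !mxE -val_eqE /= => <-.
  by apply: eq_bigr => l _; rewrite !mxE.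
have sumE f : \sum_(i < n) `|dotc f (Phi i)| ^+ 2
            = \sum_(j < k) `|w j| * (f j 0 * (f j 0)^*).
  transitivity (dotc (M1 *m (D^t* *m f)) (M1 *m (D^t* *m f))).
    apply: eq_bigr => i _; rewrite -normCK; congr (`|_| ^+ 2).
    rewrite PhiE dotcE !trmx_mul !map_mxM /= !trmxCK trmx_delta map_delta_mx.
    by rewrite -!mulmxA -rowE mxE.
  rewrite dotcE trmx_mul map_mxM /= -mulmxA (mulmxA _ M1) M1K mul1mx -dotcE.
  apply: eq_bigr => j _; rewrite tr_diag_mx map_diag_mx mul_diag_mx !mxE -normCK.
  by rewrite normrM norm_conjC exprMn -normrX sqrtCK normCK.
pose a : R[i] -> R := @ComplexField.Normc.normc R.
have aE z : (a z)%:C%C = `|z| :> R[i] by [].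
have a_ge0 (z : R[i]) : 0 <= a z by rewrite -lecR aE normr_ge0.
have aw0 i : 0 < a (w i) by rewrite -ltcR aE normr_gt0.
pose s1 : R := \sum_(i < k) (a (w i))^-1; pose s2 : R := \sum_(i < k) a (w i).
have s1_0 : 0 <= s1 by apply: sumr_ge0 => i _; rewrite invr_ge0 ltW.
have s2_0 : 0 <= s2 by apply: sumr_ge0 => i _; rewrite ltW.
have s10 : 0 < 1 + s1 by rewrite ltr_pwDl.
exists (1 + s1)^-1, (1 + s2); split; first by rewrite invr_gt0.
  apply: (@le_trans _ _ 1); last by rewrite lerDl.
  by rewrite invf_le1 // lerDl.
move=> f; rewrite sumE /dotc !mulr_sumr.
split; apply: ler_sum => j _; rewrite ler_wpM2r ?mul_conjC_ge0 // -aE lecR.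
  rewrite invf_ple ?posrE // /s1 (bigD1 j) //= addrCA lerDl addr_ge0 //.
  by apply: sumr_ge0 => i _; rewrite invr_ge0 ltW.
rewrite /s2 (bigD1 j) //= addrCA lerDl addr_ge0 //.
by apply: sumr_ge0 => i _; rewrite ltW.
Qed.

(* Main.v *)
(* For a connected graph the Gram matrix of the dual vectors S^-1 phi_j against
   the phi_i is the orthogonal projection onto the range of the Laplacian; its
   kernel is spanned by the all-ones vector, so this matrix is I - J/n.  An
   eigenvector of the error operator for a set L with eigenvalue mu <> 0 yields
   an eigenvector of the L-block of I - J/n, whose eigenvalues are 1 (attained
   at S^-1 (phi_a - phi_b) for a <> b in L) and 1 - |L|/n. *)
Require Import Defs.
From mathcomp Require Import all_boot all_order all_algebra.
From mathcomp Require Import all_classical all_reals.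
From mathcomp Require Import complex.
From mathcomp Require Import ring lra.

Import Order.TTheory GRing.Theory Num.Theory.
Local Open Scope ring_scope.
Local Open Scope sesquilinear_scope.

Lemma leigenvalueP (K : fieldType) (V : vectType K) (T : 'End(V)) (a : K) :
  reflect (exists2 f, T f = a *: f & f != 0) (passmx.leigenvalue T a).
Proof.
have kerE f : (f \in passmx.leigenspace T a) = (T f == a *: f).
  by rewrite memv_ker add_lfunE opp_lfunE scale_lfunE id_lfunE subr_eq0.
apply: (iffP idP) => [Ta|[f Tf f0]].
  exists (vpick (passmx.leigenspace T a)); last by rewrite vpick0.
  by apply/eqP; rewrite -kerE memv_pick.
apply: contraNneq f0 => T0; rewrite -memv0 -T0 kerE; exact/eqP.
Qed.

Lemma spectral_radius_eq (R : realType) d (T : 'End('cV[R[i]]_d)) (a : R[i])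
    (r : R) :
  passmx.leigenvalue T a -> `|a| = r%:C%C ->
  (forall b, passmx.leigenvalue T b -> `|b| <= r%:C%C) ->
  spectral_radius T = r.
Proof.
move=> Ta ar Tr; rewrite /spectral_radius; set E := (X in sup X).
have Er : E r by exists a => //; apply: complexI.
have ubE : ubound E r by move=> _ [b Tb <-]; rewrite -lecR; exact: Tr.
apply/eqP; rewrite eq_le ge_sup //=; last by exists r.
by apply: ub_le_sup => //; exists r.
Qed.

Lemma dotcB (R : realType) d (f g h : 'cV[R[i]]_d) :
  dotc (f - g) h = dotc f h - dotc g h.
Proof.
by rewrite /dotc -sumrB; apply: eq_bigr => k _; rewrite !mxE mulrBl.
Qed.

Lemma dotc0l (R : realType) d (h : 'cV[R[i]]_d) : dotc 0 h = 0.
Proof. by rewrite /dotc big1 // => k _; rewrite mxE mul0r. Qed.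

Lemma dotcZl (R : realType) d a (f h : 'cV[R[i]]_d) :
  dotc (a *: f) h = a * dotc f h.
Proof.
by rewrite /dotc mulr_sumr; apply: eq_bigr => k _; rewrite !mxE mulrA.
Qed.

(* Writing A' for the adjoint of A, the frame operator is D D', so the dual
   vectors are the columns of D'^-1 W', and the factor D' cancels when they are
   paired with the columns of D W'. *)
Lemma dotc_canonical_dual_mx (R : realType) n k (Phi : 'I_n -> 'cV[R[i]]_k)
    (D : 'M[R[i]]_k) (W : 'M[R[i]]_(n, k)) :
  is_frame Phi -> D \in unitmx -> W^t* *m W = 1%:M ->
  (forall i, Phi i = D *m W^t* *m delta_mx i 0) ->
  forall i j, dotc (canonical_dual Phi j) (Phi i) = (W *m W^t*) i j.
Proof.
move=> frP Du WK PhiE i j.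
have dotE f l : dotc f (Phi l) = (W *m D^t* *m f) l 0.
  rewrite PhiE dotcE !trmx_mul !map_mxM /= !trmxCK trmx_delta map_delta_mx.
  by rewrite -!mulmxA -rowE mxE.
have SE f : frame_op Phi f = D *m D^t* *m f.
  rewrite frame_opE.
  transitivity (D *m W^t* *m (W *m D^t* *m f)).
    apply/colP => l; rewrite summxE mxE; apply: eq_bigr => h _.
    by rewrite mxE dotE PhiE -colE [X in _ * X]mxE mulrC.
  by rewrite !mulmxA -(mulmxA D) WK mulmx1.
have Dtu : D^t* \in unitmx by rewrite map_unitmx unitmx_tr.
have -> : canonical_dual Phi j = invmx (D^t*) *m (W^t* *m delta_mx j 0).
  rewrite /canonical_dual.
  have -> : Phi j = frame_op Phi (invmx (D^t*) *m (W^t* *m delta_mx j 0)).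
    by rewrite SE -mulmxA mulKVmx // PhiE mulmxA.
  exact: lker0_lfunK (frame_op_ker frP) _.
by rewrite dotE -mulmxA mulKVmx // mulmxA -colE mxE.
Qed.

(** Each diagonal degree counts the ones in its adjacency row, so every row sums to zero. *)
Lemma laplacian_const1 (R : realType) n (G : sgraph n) :
  laplacian R G *m const_mx 1 = 0 :> 'cV[R[i]]_n.
Proof.
rewrite mulmxBl mul_diag_mx; apply/colP => i; rewrite !mxE mulr1.
under eq_bigr do rewrite !mxE mulr1.
apply/eqP; rewrite subr_eq0 cardsE -sum1_card big_mkcond natr_sum.
apply/eqP; apply: eq_bigr => j _.
by rewrite unfold_in -/(adj G i j); case: (adj G i j).
Qed.

(** Dropping the last column of [M] subtracts its outer product from [M *m M^t*], the identity. That
    column spans the kernel of the Laplacian, so it is constant, and its unit norm fixes the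
    entry. *)
Lemma LG_frame_gram (R : realType) m (G : sgraph m.+1)
    (Phi : 'I_m.+1 -> 'cV[R[i]]_m) :
  is_LG_frame G Phi -> forall i j,
  dotc (canonical_dual Phi j) (Phi i) = (i == j)%:R - m.+1%:R^-1.
Proof.
move=> LG i j; have frP := LG_frame_is_frame LG.
case: LG => _ [le_mn [M [lam [Mu lamP LE /= PhiE]]]].
set W := colsub _ M in PhiE; set D := diag_mx _ in PhiE.
have MMt : M *m M^t* = 1%:M by exact/unitarymxP.
have MtM : M^t* *m M = 1%:M := mulmx1C MMt.
have Du : D \in unitmx.
  rewrite unitmxE det_diag unitfE; apply/prodf_neq0 => l _.
  by rewrite mxE sqrtC_eq0 lamP /=.
have WK : W^t* *m W = 1%:M.
  apply/matrixP => p q.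
  have /matrixP/(_ (widen_ord le_mn p) (widen_ord le_mn q)) := MtM.
  rewrite !mxE -val_eqE /= => <-.
  by apply: eq_bigr => l _; rewrite !mxE.
rewrite (dotc_canonical_dual_mx _ _ _ _ _ _ frP Du WK PhiE).
have WWE : (W *m W^t*) i j = (i == j)%:R - M i ord_max * (M j ord_max)^*.
  have /matrixP/(_ i j) := MMt; rewrite !mxE big_ord_recr /= !mxE => <-.
  rewrite addrK; apply: eq_bigr => l _; rewrite !mxE.
  by rewrite (_ : widen_ord _ l = widen_ord le_mn l) //; exact: val_inj.
rewrite {}WWE; congr (_ - _).
(* Coordinates of the all-ones vector in the eigenbasis: those at nonzero eigenvalues vanish,
   leaving only [ord_max]. *)
pose v : 'cV[R[i]]_m.+1 := M^t* *m const_mx 1.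
have v0 l : l != ord_max -> v l 0 = 0.
  move=> lm; have /colP/(_ l) : diag_mx lam *m v = 0.
    by rewrite -[LHS]mul1mx -MtM -mulmxA (mulmxA M) (mulmxA (M *m _)) -LE
               laplacian_const1 mulmx0.
  rewrite mul_diag_mx mxE [RHS]mxE => /eqP; rewrite mulf_eq0.
  have l_lt : (l < m)%N by rewrite ltn_neqAle -ltnS ltn_ord andbT.
  by rewrite (negPf (etrans (lamP l) l_lt)) => /eqP.
pose c := v ord_max 0.
have Mc l : M l ord_max * c = 1.
  have /colP/(_ l) : M *m v = const_mx 1 by rewrite mulmxA MMt mul1mx.
  rewrite !mxE (bigD1 ord_max) //= big1 ?addr0 // => h hm.
  by rewrite v0 ?mulr0.
have c0 : c != 0.
  by apply: contra_eq_neq (Mc i) => ->; rewrite mulr0 eq_sym oner_eq0.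
have ME l : M l ord_max = c^-1 by rewrite -[RHS]mul1r -(Mc l) mulfK.
(* The phase of [c] is unknown, but only the squared modulus of [c^-1] is needed. *)
have /matrixP/(_ ord_max ord_max) := MtM.
rewrite !mxE eqxx; under eq_bigr do rewrite !mxE ME.
rewrite sumr_const card_ord => c_norm.
have m0 : m.+1%:R != 0 :> R[i] by rewrite pnatr_eq0.
by apply: (mulfI m0); rewrite !ME mulfV // mulr_natl [c^-1 * _]mulrC.
Qed.

(** Two indices in [L] provide the eigenvalue 1. The only other nonzero candidate is
    [1 - #|L|%:R * c], which the bounds on [c] keep in [-1, 1]. *)
Lemma error_op_spectral_radius (R : realType) n d
    (Phi Psi : 'I_n -> 'cV[R[i]]_d) (c : R) (L : {set 'I_n}) :
  (forall i j, dotc (Psi j) (Phi i) = (i == j)%:R - c%:C%C) ->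
  0 <= c -> #|L|%:R * c <= 2 -> (1 < #|L|)%N ->
  spectral_radius (error_op Phi Psi L) = 1.
Proof.
move=> gram c_ge0 Lc2 /card_gt1P[a [b [aL bL ab]]].
apply: (@spectral_radius_eq _ _ _ 1); rewrite ?normr1 //.
  (* In the difference the constant [c] cancels: its pairings with the [Phi i] are 1 at [a], -1 at
     [b] and 0 elsewhere. *)
  apply/leigenvalueP; exists (Psi a - Psi b); last first.
    apply/eqP => /(congr1 (fun f => dotc f (Phi a))).
    rewrite dotcB !gram dotc0l eqxx (negPf ab) => /eqP.
    by rewrite sub0r opprK subrK oner_eq0.
  rewrite error_opE scale1r (bigD1 a) //= (bigD1 b) /= ?bL 1?eq_sym //.
  rewrite big1 => [|i /andP[/andP[_ ia] ib]].
    rewrite !dotcB !gram !eqxx (negPf ab) eq_sym (negPf ab) addr0.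
    by rewrite !(opprB, addrA, subrK) subr0 sub0r mulr1n scale1r scaleN1r.
  by rewrite dotcB !gram (negPf ia) (negPf ib) subrr scale0r.
move=> mu /leigenvalueP[f Ef f0].
pose x i := dotc f (Phi i); pose s := \sum_(i in L) x i.
(* Pair the eigenvector equation with [Phi i]. *)
have mu_x i : i \in L -> mu * x i = x i - c%:C%C * s.
  move=> iL; rewrite /x -dotcZl -Ef error_opE dotc_suml -/x.
  under eq_bigr do rewrite gram mulrBr.
  rewrite sumrB -mulr_suml (mulrC s); congr (_ - _).
  rewrite (bigD1 i) //= eqxx mulr1 big1 ?addr0 // => j /andP[_ ji].
  by rewrite eq_sym (negPf ji) mulr0.
have [s0|s_neq0] := eqVneq s 0.
  have [->|mu0] := eqVneq mu 0; first by rewrite normr0.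
  have [->|mu1] := eqVneq mu 1; first by rewrite normr1.
  (* With [s = 0] and [mu] not 1, all coefficients on [L] vanish, so [mu *: f = 0], which is
     absurd. *)
  have x0 i : i \in L -> x i = 0.
    move=> iL; apply/eqP; have /eqP := mu_x i iL.
    rewrite s0 mulr0 subr0 -subr_eq0 -{2}[x i]mul1r -mulrBl mulf_eq0 subr_eq0.
    by rewrite (negPf mu1).
  have /eqP : mu *: f = 0.
    by rewrite -Ef error_opE big1 // => i iL; rewrite -/(x i) x0 // scale0r.
  by rewrite scaler_eq0 (negPf mu0) (negPf f0).
(* Sum [mu_x] over [L] and cancel [s]. *)
have -> : mu = (1 - #|L|%:R * c)%:C%C.
  apply: (mulIf s_neq0); rewrite mulr_sumr (eq_bigr _ mu_x) sumrB sumr_const.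
  by rewrite rmorphB rmorphM /= rmorph1 rmorph_nat -/s -mulr_natl; ring.
rewrite normc_def /= expr0n addr0 sqrtr_sqr lecR ler_norml.
have Lc_ge0 : 0 <= #|L|%:R * c by exact: mulr_ge0.
by apply/andP; split; lra.
Qed.

Theorem theorem4p1 (R : realType) (n : nat) (G : sgraph n)
    (Phi : 'I_n -> 'cV[R[i]]_(n.-1)) :
  (3 <= n)%N -> connected_graph G -> is_LG_frame G Phi ->
  rho_erasure 2 Phi (canonical_dual Phi) = 1.
Proof.
case: n G Phi => // m G Phi m_ge2 _ /LG_frame_gram gram.
have rho1 (L : {set 'I_m.+1}) : #|L| == 2 ->
    spectral_radius (error_op Phi (canonical_dual Phi) L) = 1.
  move=> /eqP L2; apply: (@error_op_spectral_radius _ _ _ _ _ m.+1%:R^-1).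
  - by move=> i j; rewrite gram fmorphV /= rmorph_nat.
  - by rewrite invr_ge0.
  - by rewrite L2 ler_piMr // invf_le1 ?ltr0n // ler1n.
  - by rewrite L2.
rewrite /rho_erasure (eq_bigr _ rho1); apply/eqP; rewrite eq_le.
rewrite bigmax_le //=.
(* An actual two-element set is needed to lift the maximum above its default 0. *)
have lt1m : (1 < m.+1)%N by exact: ltnW.
apply: (bigmax_sup [set ord0; Ordinal lt1m]%SET) => //.
by rewrite cards2.
Qed.
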